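(* Let $X\subset\mathbb Z^n$ be a finite digital image with $c_1$-adjacency, where $n\le 3$, and let $f,g:X\to X$ be continuous maps that are homotopic. Then $\bar L(f)=\bar L(g)$.
   Context: On $\mathbb Z^n$, the $c_1$-adjacency declares two points adjacent iff they differ by $\pm1$ in exactly one coordinate and agree in all others. Write $x\leftrightarrow y$ for adjacent and $x\Leftrightarrow y$ for adjacent or equal; a map is continuous if $x\leftrightarrow y$ implies $f(x)\Leftrightarrow f(y)$. The digital interval $[0,m]_{\mathbb Z}$ has consecutive integers adjacent. Continuous $f,g:X\to Y$ are homotopic if there exist $m\ge1$ and $H:X\times[0,m]_{\mathbb Z}\to Y$ with $H(\cdot,0)=f$, $H(\cdot,m)=g$, each $t\mapsto H(x,t)$ continuous and each $x\mapsto H(x,t)$ continuous. Cubical homology: an elementary interval is $\{a,a+1\}$ (nondegenerate) or $\{a\}$ (degenerate), $a\in\mathbb Z$; an elementary cube is $\sigma=t_1\times\dots\times t_n$ with each $t_i$ an elementary interval, and its dimension $q$ is the number of nondegenerate factors. $\bar C_q(X)$ is the free abelian group on the elementary $q$-cubes contained in $X$. With $A_i\sigma$ (resp. $B_i\sigma$) obtained by replacing $t_i$ by $\{\min t_i\}$ (resp. $\{\max t_i\}$), and $j_1<\dots<j_q$ the indices of nondegenerate factors, $\partial\sigma=\sum_{i=1}^q(-1)^i(A_{j_i}\sigma-B_{j_i}\sigma)$; $\bar H_q(X)$ is the homology. For continuous $f:X\to Y$ ($Y\subset\mathbb Z^m$ with $c_1$), define $\bar f_q(\sigma)=0$ if $f(\sigma)$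 is not an elementary $q$-cube; otherwise $\tau=f(\sigma)$ is a $q$-cube, and identifying $\sigma$ and $\tau$ with $\{0,1\}^q$ via their nondegenerate coordinates (in increasing order, shifted by their minima), $f|_\sigma$ has the form $(x_1,\dots,x_q)\mapsto(y_1,\dots,y_q)$ with each $y_i\in\{x_{\pi(i)},1-x_{\pi(i)}\}$ for a permutation $\pi$; set $\bar f_q(\sigma)=\operatorname{sgn}(\pi)(-1)^r\tau$, where $r$ is the number of $i$ with $y_i=1-x_{\pi(i)}$. It is known that for $X\subset\mathbb Z^n$ with $n\le4$ these $\bar f_q$ form a chain map, inducing $\bar f_{*,q}:\bar H_q(X)\to\bar H_q(Y)$. For a self-map $f$ of such $X$, the cubical Lefschetz number is $\bar L(f)=\sum_{q\ge0}(-1)^q\operatorname{tr}(\bar f_{*,q})$, traces taken on $\bar H_q(X)\otimes\mathbb Q$. *)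

(* Defs.v *)
From HB Require Import structures.
From mathcomp Require Import all_boot all_order all_algebra all_fingroup.
From mathcomp Require Import finmap.
Set Implicit Arguments. Unset Strict Implicit. Unset Printing Implicit Defensive.
Import Order.TTheory GRing.Theory Num.Theory.
Local Open Scope ring_scope.

Notation pt n := 'rV[int]_n.

Definition c1adj n (x y : pt n) : bool :=
  [exists i : 'I_n, (`|x 0 i - y 0 i| == 1) &&
                    [forall j : 'I_n, (j != i) ==> (x 0 j == y 0 j)]].
Definition c1adjeq n (x y : pt n) : bool := (x == y) || c1adj x y.

Definition maps_into n (X : {fset pt n}) (f : pt n -> pt n) : Prop :=
  forall x, x \in X -> f x \in X.

Definition dcontinuous n (X : {fset pt n}) (f : pt n -> pt n) : Prop :=
  forall x y, x \in X -> y \in X -> c1adj x y -> c1adjeq (f x) (f y).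

Definition dhomotopic n (X : {fset pt n}) (f g : pt n -> pt n) : Prop :=
  exists m : nat, exists H : pt n -> nat -> pt n,
    (1 <= m)%N /\
    (forall x, x \in X -> H x 0%N = f x) /\
    (forall x, x \in X -> H x m = g x) /\
    (forall x t, x \in X -> (t <= m)%N -> H x t \in X) /\
    (forall x t, x \in X -> (t < m)%N -> c1adjeq (H x t) (H x t.+1)) /\
    (forall t, (t <= m)%N -> dcontinuous X (fun x => H x t)).

(* An elementary cube is (a, S): a the minimal corner, S the set of
   nondegenerate coordinates. Its dimension is #|S|. *)
Definition cube n := (pt n * {set 'I_n})%type.

Definition ndc n (S : {set 'I_n}) (k : nat) : nat := nth 0%N (map val (enum S)) k.

(* vertex of cube c with coordinates x in {0,1}^q along the
   nondegenerate directions (in increasing order) *)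
Definition vert n q (c : cube n) (x : {ffun 'I_q -> bool}) : pt n :=
  \row_(i < n) (c.1 0 i + ((\sum_(k < q | x k) ((val i == ndc c.2 k) : nat))%N)%:Z).
Arguments vert {n} q c x.

Definition cube_in n (X : {fset pt n}) q (c : cube n) : bool :=
  (#|c.2| == q)%N && [forall x : {ffun 'I_q -> bool}, vert q c x \in X].

(* the elementary q-cubes contained in X (a basis of C_q(X)) *)
Definition cubes n (X : {fset pt n}) q : seq (cube n) :=
  [seq c <- [seq (a, T) | a <- enum_fset X, T <- enum {set 'I_n}] | cube_in X q c].

Definition cube0 n : cube n := (0, set0).
Definition Ncub n (X : {fset pt n}) q := size (cubes X q).
Definition cub n (X : {fset pt n}) q (i : nat) : cube n := nth (cube0 n) (cubes X q) i.

Definition unitv n (j : 'I_n) : pt n := delta_mx 0 j.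

(* coefficient of tau in the boundary of sigma:
   sum over nondegenerate j (the k-th, k 1-based) of (-1)^k (A_j - B_j) *)
Definition bdcoef n (s t : cube n) : rat :=
  \sum_(j in s.2)
    (-1) ^+ #|[set i in s.2 | (i <= j)%N]| *
      (((t == (s.1, s.2 :\ j)) : nat)%:R - ((t == (s.1 + unitv j, s.2 :\ j)) : nat)%:R).

(* boundary matrix, row-vector convention: C_q -> C_(q-1) *)
Definition bdmx n (X : {fset pt n}) q : 'M[rat]_(Ncub X q, Ncub X q.-1) :=
  \matrix_(i, j) bdcoef (cub X q i) (cub X q.-1 j).

Definition image_is n q (f : pt n -> pt n) (s t : cube n) : bool :=
  [forall x : {ffun 'I_q -> bool}, exists y : {ffun 'I_q -> bool},
       f (vert q s x) == vert q t y] &&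
  [forall y : {ffun 'I_q -> bool}, exists x : {ffun 'I_q -> bool},
       f (vert q s x) == vert q t y].

(* sgn(pi) (-1)^r, where f|sigma is (x_1..x_q) |-> (y_1..y_q),
   y_i = x_{pi i} or 1 - x_{pi i} (flipped iff eps i) *)
Definition fsign n q (f : pt n -> pt n) (s t : cube n) : rat :=
  match [pick pe : {perm 'I_q} * {ffun 'I_q -> bool} |
           [forall x : {ffun 'I_q -> bool},
              f (vert q s x) == vert q t [ffun i => x (pe.1 i) (+) pe.2 i]]] with
  | Some pe => (-1) ^+ (odd_perm pe.1) * (-1) ^+ #|[set i | pe.2 i]|
  | None => 0
  end.

Definition fcoef n q (f : pt n -> pt n) (s t : cube n) : rat :=
  if image_is q f s t then fsign q f s t else 0.

(* matrix of the induced chain map \bar f_q (row-vector convention) *)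
Definition chainmx n (X : {fset pt n}) (f : pt n -> pt n) q : 'M[rat]_(Ncub X q) :=
  \matrix_(i, j) fcoef q f (cub X q i) (cub X q j).

(* trace of \bar f_{*,q} on H_q(X) (x) Q = ker d_q / im d_(q+1):
   W is a complement of im d_(q+1) in ker d_q, so the rows of row_base W
   give a basis of the quotient; the matrix of the induced map in that basis
   is obtained by applying f, projecting onto W along im d_(q+1), and taking
   coordinates. *)
Definition homtrace n (X : {fset pt n}) (f : pt n -> pt n) q : rat :=
  let W := (kermx (bdmx X q) :\: bdmx X q.+1)%MS in
  \tr (row_base W *m chainmx X f q *m proj_mx W (<<bdmx X q.+1>>)%MS
        *m pinvmx (row_base W)).

(* cubical Lefschetz number; there are no q-cubes for q > n *)
Definition lefschetz n (X : {fset pt n}) (f : pt n -> pt n) : rat :=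
  \sum_(q < n.+1) (-1) ^+ q * homtrace X f q.

(* Main.v *)
Require Import Defs.
From HB Require Import structures.
From mathcomp Require Import all_boot all_order all_algebra all_fingroup.
From mathcomp Require Import finmap zify ring lra.
Set Implicit Arguments. Unset Strict Implicit. Unset Printing Implicit Defensive.
Import Order.TTheory GRing.Theory Num.Theory.
Local Open Scope ring_scope.

(** One step of the homotopy is a continuous map from X x [0,1] to X, and the prism
    operator it induces is a chain homotopy between the two chain maps; traces on
    homology then agree. The prism identity is the chain map property on one abstract
    cube {0,1}^q mapped to the lattice, by induction on q. If the map is a cube
    isomorphism this is a computation of signs. Otherwise the image z of the boundary
    must vanish: by induction z is a cycle, it is carried by at most 2q cubes (one for
    each facet), and a nonzero (q-1)-cycle of the lattice contains at least 2q cubes.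
    So if z were nonzero, all facets would be mapped isomorphically onto distinct
    cubes, which forces the whole map to be an isomorphism. *)

(** * Cycles in the cubical lattice *)

(** The obstacle is a map that is not an isomorphism of the cube although it maps some facets
    isomorphically. Their images have to cancel, and which facet cancels which depends on how the
    map folds the cube; counting cubes of a cycle avoids that case analysis. The bound 2q comes from
    slicing a cycle across one of its directions: the slice is a cycle one dimension lower, and two
    further cubes, transversal to the sliced ones, close it from below and above. Gluing the facets
    is easy for q at least 3, since any two directions then lie in a common facet. For a square,
    four nondegenerate edges may still backtrack, and only the distinctness of their images excludes
    this. Coefficients are attached to maps from {0,1}^q to the lattice because the prism over a
    cube is such a map without being a self-map restricted to a cube of [X]. *)

Section Chains.
Variable n : nat.
Implicit Types (z : cube n -> rat) (t c : cube n) (T : {set 'I_n}) (i j : 'I_n).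

(** For [j] outside [T], the sign that [bdcoef] gives to direction [j] in a cube with directions
    [j |: T]. *)
Definition dirsign T j : rat := (-1) ^+ #|[set i in j |: T | (i <= j)%N]|.

(* Evaluated through the cofaces of [t], hence meaningful without any finiteness
   assumption on the support of [z]. *)
Definition bd z t : rat :=
  \sum_(j | j \notin t.2)
    dirsign t.2 j * (z (t.1, j |: t.2) - z (t.1 - unitv j, j |: t.2)).

Lemma sum_delta z (S : seq (cube n)) c :
  uniq S -> (z c != 0 -> c \in S) ->
  \sum_(s <- S) (s == c)%:R * z s = z c.
Proof.
move=> uS Sc; have [cS|cS] := boolP (c \in S).
  rewrite (bigD1_seq c) //= eqxx mul1r big1 ?addr0 // => s /negbTE ->.
  by rewrite mul0r.
rewrite big_seq big1 => [|s sS].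
  by case: (eqVneq (z c) 0) => // /Sc; rewrite (negbTE cS).
by case: eqP => [e|_]; [rewrite -e sS in cS|rewrite mul0r].
Qed.

(** Links matrix products with [bd]: for each direction [j] outside [t.2], just two cubes have [t]
    as a facet transversal to [j], one starting at [t.1] and one ending there. *)
Lemma bd_seq z (S : seq (cube n)) t :
  uniq S -> (forall c, z c != 0 -> c \in S) ->
  \sum_(s <- S) z s * bdcoef s t = bd z t.
Proof.
move=> uS Sz; rewrite /bdcoef /bd.
under eq_bigr => s _ do rewrite big_distrr /=.
rewrite (exchange_big_dep predT) //= [RHS]big_mkcond /=.
apply: eq_bigr => j _.
have [jt|jt] /= := boolP (j \in t.2).
  rewrite big1 // => s js.
  have h a b : (t == (a, b :\ j)) = false.
    by apply/eqP => e; move: jt; rewrite e /= !inE eqxx.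
  by rewrite !h subrr !mulr0.
rewrite mulrBr -(sum_delta uS (Sz (t.1, j |: t.2))).
rewrite -(sum_delta uS (Sz (t.1 - unitv j, j |: t.2))).
rewrite !big_distrr /= -sumrB big_mkcond /=; apply: eq_bigr => -[a T] _ /=.
have [jT|jT] := boolP (j \in T); last first.
  have h b : ((a, T) == (b, j |: t.2)) = false.
    by apply/eqP => -[_ e]; move: jT; rewrite e !inE eqxx.
  by rewrite !h !mul0r !mulr0 subrr.
have h (b : pt n) : (t == (b, T :\ j)) = ((b, T) == (t.1, j |: t.2)).
  apply/eqP/eqP => [->|[-> ->]] /=; first by rewrite setD1K.
  by rewrite setU1K //; case: (t).
rewrite !h // !xpair_eqE (can2_eq (addrK _) (subrK _)) /dirsign.
have [->|] := eqVneq T (j |: t.2); last by move=> _; rewrite !andbF; ring.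
by rewrite !andbT; ring.
Qed.

Lemma bd_sum (I : finType) (w : I -> rat) (F : I -> cube n -> rat) t :
  bd (fun c => \sum_k w k * F k c) t = \sum_k w k * bd (F k) t.
Proof.
rewrite /bd; under [RHS]eq_bigr do rewrite big_distrr /=.
rewrite [RHS]exchange_big /=; apply: eq_bigr => j _.
rewrite -sumrB big_distrr /=; apply: eq_bigr => k _.
by rewrite -mulrBr mulrCA.
Qed.

Lemma bdB (F G : cube n -> rat) t :
  bd (fun c => F c - G c) t = bd F t - bd G t.
Proof.
rewrite /bd -sumrB; apply: eq_bigr => j _; rewrite -mulrBr; congr (_ * _); ring.
Qed.

Lemma dirsignE T j : j \notin T ->
  dirsign T j = - (-1) ^+ #|[set i in T | (i < j)%N]|.
Proof.
move=> jT; rewrite /dirsign.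
have -> : [set i in j |: T | (i <= j)%N] = j |: [set i in T | (i < j)%N].
  apply/setP => i; rewrite !inE leq_eqVlt -(inj_eq val_inj) /=.
  case: (eqVneq i j) => [->|]; first by rewrite eqxx.
  by rewrite -(inj_eq val_inj) => /negbTE ->.
by rewrite cardsU1 !inE ltnn andbF exprS mulN1r.
Qed.

Lemma dirsign_neq0 T j : dirsign T j != 0.
Proof. by rewrite /dirsign signr_eq0. Qed.

Lemma card_ltU1 T i j : i \notin T ->
  #|[set x in i |: T | (x < j)%N]| = ((i < j) + #|[set x in T | (x < j)%N]|)%N.
Proof.
move=> iT; case: (ltnP i j) => ij.
  have -> : [set x in i |: T | (x < j)%N] = i |: [set x in T | (x < j)%N].
    by apply/setP => x; rewrite !inE; case: eqP => [->|]; rewrite ?ij.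
  by rewrite cardsU1 !inE (negbTE iT).
apply: eq_card => x; rewrite !inE; case: eqP => [->|] //.
by rewrite ltnNge ij (negbTE iT).
Qed.

(** Inserting the smaller index raises the position of the larger one and not conversely, so exactly
    one sign changes with the order. *)
Lemma dirsign_swap T i j : i \notin T -> j \notin T -> i != j ->
  dirsign T j * dirsign (j |: T) i = - (dirsign T i * dirsign (i |: T) j).
Proof.
move=> iT jT ij; rewrite !dirsignE ?inE ?negb_or ?ij 1?eq_sym ?ij //.
rewrite !card_ltU1 // !exprD.
move: ij; rewrite -(inj_eq val_inj) neq_ltn => /orP[] h.
  by rewrite h ltnNge (ltnW h) /=; ring.
by rewrite h ltnNge (ltnW h) /=; ring.
Qed.

(** The slice of [z] by the hyperplane at height l + 1/2 in coordinate [i], with the sign that makes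
    slicing anticommute with [bd]. *)
Definition slab z i (l : int) t : rat :=
  if (i \notin t.2) && (t.1 0 i == l) then dirsign t.2 i * z (t.1, i |: t.2) else 0.

Lemma unitvE i j : unitv j 0 i = (i == j)%:R.
Proof. by rewrite mxE eqxx. Qed.

(** Directions other than [i] do not change the height, so all cofaces of a cube that crosses the
    slab cross it too. The boundary of the slice at [(a, T)] is therefore, up to sign, that of [z]
    at [(a, i |: T)]. *)
Lemma bd_slab z i l : (forall t, bd z t = 0) -> forall t, bd (slab z i l) t = 0.
Proof.
move=> zz [a T]; rewrite /bd /=.
have [iT|iT] := boolP (i \in T).
  rewrite big1 // => j _; rewrite /slab /= !inE iT orbT /= subrr.
  by rewrite mulr0.
have [al|al] := eqVneq (a 0 i) l; last first.
  rewrite big1 // => j _; rewrite /slab /= !inE (negbTE iT) orbF.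
  have [ij|ij] /= := eqVneq i j; first by rewrite subrr mulr0.
  by rewrite !mxE eqxx /= (negbTE ij) subr0 (negbTE al) subrr mulr0.
rewrite (bigD1 i) //= {1 2}/slab /= !inE eqxx /= subrr mulr0 add0r.
transitivity (- dirsign T i * bd z (a, i |: T)); last by rewrite zz mulr0.
rewrite /bd big_distrr /=.
apply: eq_big => [j|j /andP[jT ji]]; first by rewrite !inE negb_or andbC.
rewrite /slab /= !inE !(negbTE iT) !orbF [i == j]eq_sym ji /= !mxE eqxx /=.
rewrite [i == j]eq_sym (negbTE ji) subr0 al eqxx /= -mulrBr mulrA.
rewrite dirsign_swap 1?eq_sym // setUCA; ring.
Qed.

Lemma seq_argmin (A : eqType) (key : A -> int) (s : seq A) (x0 : A) :
  x0 \in s -> exists2 x, x \in s & forall y, y \in s -> key x <= key y.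
Proof.
elim: s x0 => // a s IH x0 _.
case: s IH => [|b s] IH.
  by exists a; rewrite ?inE // => y; rewrite inE => /eqP ->.
have [x xs xm] := IH b (mem_head _ _).
have [ax|xa] := leP (key a) (key x).
  exists a; first exact: mem_head.
  move=> y; rewrite inE => /orP[/eqP->//|/xm]; exact: le_trans.
exists x; first by rewrite inE xs orbT.
by move=> y; rewrite inE => /orP[/eqP->|/xm //]; exact: ltW.
Qed.

(* Pairing a 1-cycle with the coboundary of the half-space [x_i > a_i]. *)
Lemma cycle1_slab z (S : seq (cube n)) (a : pt n) i :
  (forall t, z t != 0 -> t \in S) ->
  (forall t, z t != 0 -> #|t.2| = 1%N) ->
  (forall t, bd z t = 0) -> z (a, [set i]) != 0 ->
  exists b, [/\ b != a, b 0 i = a 0 i & z (b, [set i]) != 0].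
Proof.
move=> Sz dz zz za.
have [/hasP[b bS /and3P[ba bi zb]]|/hasPn none] :=
  boolP (has (fun b => [&& b != a, b 0 i == a 0 i & z (b, [set i]) != 0]) (map fst S)).
  by exists b; split => //; exact/eqP.
have {}none b : b != a -> b 0 i = a 0 i -> z (b, [set i]) = 0.
  move=> ba bi; apply/eqP; apply: contraT => zb.
  have := none b; rewrite (map_f fst (Sz _ zb)) => /(_ isT).
  by rewrite ba bi eqxx zb.
exfalso; move/negP: za; apply.
pose S' := undup S.
have S'z c : z c != 0 -> c \in S' by rewrite mem_undup; exact: Sz.
(* A finite set of vertices containing both ends of every edge of the cycle, so that the pairing
   with [psi] is a finite sum. *)
pose V := undup (map fst S ++ [seq t.1 + unitv j | t <- S, j <- enum 'I_n]).
pose psi (x : pt n) : rat := (a 0 i < x 0 i)%R%:R.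
have H : \sum_(x <- V) psi x * bd z (x, set0) = 0.
  by rewrite big1 // => x _; rewrite zz mulr0.
move: H.
under eq_bigr => x _ do rewrite -(bd_seq (x, set0) (undup_uniq S) S'z) big_distrr /=.
rewrite exchange_big /=.
(* Each edge contributes its coefficient times the jump of [psi] along it. Only edges in direction
   [i] at height [a 0 i] see a jump, and [none] leaves one of them. *)
have -> : \sum_(s <- undup S) \sum_(x <- V) psi x * (z s * bdcoef s (x, set0)) =
   \sum_(s <- S') (s == (a, [set i]))%:R * z s.
  apply: eq_big_seq => -[b T] sS.
  have [z0|z1] := eqVneq (z (b, T)) 0.
    by rewrite z0 mulr0 big1 // => x _; rewrite mul0r mulr0.
  have /eqP/cards1P[j /= Tj] := dz _ z1; subst T.
  have bV : b \in V.
    rewrite mem_undup mem_cat; apply/orP; left.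
    by apply/mapP; exists (b, [set j]) => //; exact: Sz.
  have bjV : b + unitv j \in V.
    rewrite mem_undup mem_cat; apply/orP; right.
    apply/allpairsP; exists ((b, [set j]), j); split => //=; first exact: Sz.
    by rewrite mem_enum.
  have -> : \sum_(x <- V) psi x * (z (b, [set j]) * bdcoef (b, [set j]) (x, set0)) =
    z (b, [set j]) * (psi (b + unitv j) - psi b).
    have hd y : y \in V -> \sum_(x <- V) (x == y)%:R * psi x = psi y.
      move=> yV; rewrite (bigD1_seq y) ?undup_uniq //= eqxx mul1r big1 ?addr0 //.
      by move=> x /negbTE ->; rewrite mul0r.
    rewrite -(hd _ bV) -(hd _ bjV) -sumrB big_distrr /=; apply: eq_bigr => x _.
    rewrite /bdcoef /= big_set1.
    have -> : [set i0 in [set j] | (i0 <= j)%N] = [set j].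
      by apply/setP => k; rewrite !inE; case: eqP => [->|] //; rewrite leqnn.
    have h y : ((x, set0) == (y, [set j] :\ j)) = (x == y).
      by rewrite xpair_eqE setDv eqxx andbT.
    by rewrite cards1 !h; ring.
  rewrite /psi mxE unitvE.
  have -> : ((b, [set j]) == (a, [set i])) = (b == a) && (j == i).
    by rewrite xpair_eqE; congr (_ && _); apply/eqP/eqP => [/set1_inj|->].
  have [ji|ji] := @eqVneq _ j i; last first.
    by rewrite addr0 subrr mulr0 andbF mul0r.
  rewrite ji andbT.
  have [->|ba] := eqVneq b a; first by rewrite ltxx /= ltrDl ltr01 subr0 mulrC.
  have [bi|bi] := eqVneq (b 0 i) (a 0 i); first by rewrite none // mulr0 mul0r.
  have -> : (a 0 i < b 0 i + 1) = (a 0 i < b 0 i).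
    by rewrite ltzD1 lt_neqAle eq_sym bi.
  by rewrite subrr mulr0 mul0r.
by rewrite (sum_delta (undup_uniq S)) // => [->//|]; exact: S'z.
Qed.

(** Let [t] be lowest among the cubes with direction [i]. No cube below [t] can cancel its lower
    face, so a coface in another direction [j] must do it; that coface is [b]. *)
Lemma cycle_bottom z (S : seq (cube n)) t0 i :
  (forall t, z t != 0 -> t \in S) -> (forall t, bd z t = 0) ->
  z t0 != 0 -> i \in t0.2 ->
  exists t b,
    [/\ z t != 0, i \in t.2, z b != 0, i \notin b.2 & b.1 0 i = t.1 0 i].
Proof.
move=> Sz zz z0 i0.
have t0in : t0 \in [seq t <- S | (z t != 0) && (i \in t.2)].
  by rewrite mem_filter z0 i0 Sz.
have [t] := seq_argmin (fun u : cube n => u.1 0 i) t0in.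
rewrite mem_filter => /andP[/andP[zt it] tS] tmin.
have {}tmin u : z u != 0 -> i \in u.2 -> t.1 0 i <= u.1 0 i.
  by move=> zu iu; apply: tmin; rewrite mem_filter zu iu Sz.
have := zz (t.1, t.2 :\ i); rewrite /bd /= (bigD1 i) ?inE ?eqxx //=.
rewrite setD1K //.
have -> : z (t.1 - unitv i, t.2) = 0.
  apply/eqP; apply: contraT => /tmin; rewrite it => /(_ isT) /=.
  by rewrite !mxE !eqxx /= lerBrDr gerDl ler10.
rewrite subr0 => h.
have /existsP : [exists j, ((j \notin t.2 :\ i) && (j != i)) &&
   (z (t.1, j |: t.2 :\ i) - z (t.1 - unitv j, j |: t.2 :\ i) != 0)].
  apply: contraT => /existsPn no.
  move: h; rewrite big1 => [/eqP|j hj]; last first.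
    by move: (no j); rewrite hj /= negbK => /eqP ->; rewrite mulr0.
  rewrite addr0 mulf_eq0 (negbTE (dirsign_neq0 _ _)) /=.
  by move: zt; rewrite {1}[t]surjective_pairing => /negbTE ->.
case=> j /andP[/andP[jt ji]].
have [z1|z1 _] := eqVneq (z (t.1, j |: t.2 :\ i)) 0.
  rewrite z1 sub0r oppr_eq0 => z2.
  exists t, (t.1 - unitv j, j |: t.2 :\ i); split => //=.
    by rewrite !inE eqxx /= orbF eq_sym.
  by rewrite !mxE eqxx /= eq_sym (negbTE ji) subr0.
exists t, (t.1, j |: t.2 :\ i); split => //=.
by rewrite !inE eqxx /= orbF eq_sym.
Qed.

(** The mirror image of [cycle_bottom], at the upper face of a highest cube. The strict inequality
    is what later separates the top cube from the bottom one. *)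
Lemma cycle_top z (S : seq (cube n)) t0 i :
  (forall t, z t != 0 -> t \in S) -> (forall t, bd z t = 0) ->
  z t0 != 0 -> i \in t0.2 ->
  exists b, [/\ z b != 0, i \notin b.2 & t0.1 0 i < b.1 0 i].
Proof.
move=> Sz zz z0 i0.
have t0in : t0 \in [seq t <- S | (z t != 0) && (i \in t.2)].
  by rewrite mem_filter z0 i0 Sz.
have [t] := seq_argmin (fun u : cube n => - u.1 0 i) t0in.
rewrite mem_filter => /andP[/andP[zt it] tS] tmax.
have {}tmax u : z u != 0 -> i \in u.2 -> u.1 0 i <= t.1 0 i.
  by move=> zu iu; rewrite -lerN2; apply: tmax; rewrite mem_filter zu iu Sz.
have t01 := tmax _ z0 i0.
have := zz (t.1 + unitv i, t.2 :\ i); rewrite /bd /= (bigD1 i) ?inE ?eqxx //=.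
rewrite setD1K // addrK.
have -> : z (t.1 + unitv i, t.2) = 0.
  apply/eqP; apply: contraT => /tmax; rewrite it => /(_ isT) /=.
  by rewrite !mxE !eqxx /= gerDl ler10.
rewrite sub0r => h.
have /existsP : [exists j, ((j \notin t.2 :\ i) && (j != i)) &&
   (z (t.1 + unitv i, j |: t.2 :\ i) - z (t.1 + unitv i - unitv j, j |: t.2 :\ i) != 0)].
  apply: contraT => /existsPn no.
  move: h; rewrite big1 => [/eqP|j hj]; last first.
    by move: (no j); rewrite hj /= negbK => /eqP ->; rewrite mulr0.
  rewrite addr0 mulrN oppr_eq0 mulf_eq0 (negbTE (dirsign_neq0 _ _)) /=.
  by move: zt; rewrite {1}[t]surjective_pairing => /negbTE ->.
case=> j /andP[/andP[jt ji]].
have [z1|z1 _] := eqVneq (z (t.1 + unitv i, j |: t.2 :\ i)) 0.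
  rewrite z1 sub0r oppr_eq0 => z2.
  exists (t.1 + unitv i - unitv j, j |: t.2 :\ i); split => //=.
    by rewrite !inE eqxx /= orbF eq_sym.
  by rewrite !mxE !eqxx /= eq_sym (negbTE ji) subr0 ltzD1.
exists (t.1 + unitv i, j |: t.2 :\ i); split => //=.
  by rewrite !inE eqxx /= orbF eq_sym.
by rewrite !mxE !eqxx /= ltzD1.
Qed.

(* The slab of a cycle just above its lowest level is a cycle of one dimension
   less, and the cycle has two more cubes closing it from below and from above. *)
Lemma cycle_support_size d z (S : seq (cube n)) t0 :
  (forall t, z t != 0 -> t \in S) -> (forall t, z t != 0 -> #|t.2| = d.+1) ->
  (forall t, bd z t = 0) -> z t0 != 0 ->
  exists L, [/\ uniq L, size L = (2 * d.+2)%N & forall t, t \in L -> z t != 0].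
Proof.
elim: d z S t0 => [|d IH] z S t0 Sz dz zz z0.
all: have /card_gt0P[i i0] : (0 < #|t0.2|)%N by rewrite (dz _ z0).
all: have [t [b [zt it zb ib bt]]] := cycle_bottom Sz zz z0 i0.
all: have [b' [zb' ib' tb']] := cycle_top Sz zz zt it.
all: have bb' : b != b' by apply/eqP => e; move: tb'; rewrite -bt e ltxx.
  (* The slice of a 1-cycle is a set of points, where being a cycle says nothing; [cycle1_slab]
     supplies the second edge, which makes four cubes. *)
  have /eqP/cards1P[k tk] := dz _ zt.
  have ik : k = i by move: it; rewrite tk inE => /eqP.
  subst k.
  have zt' : z (t.1, [set i]) != 0 by rewrite -tk -surjective_pairing.
  have [a [at1 ai za]] := cycle1_slab Sz dz zz zt'.
  exists [:: (a, [set i]); (t.1, [set i]); b; b']; split => //=.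
    have h c : i \notin c.2 -> forall y, ((y, [set i]) == c) = false.
      by move=> ic y; apply/eqP => e; move: ic; rewrite -e /= inE eqxx.
    by rewrite !inE !(h b) // !(h b') // xpair_eqE (negbTE at1) /= bb'.
  move=> u; rewrite !inE => /or4P[] /eqP -> //.
(* The cubes found in the slice have direction [i] once put back into [z], hence differ from [b] and
   [b']. *)
pose w := slab z i (t.1 0 i).
pose S' : seq (cube n) := [seq (c.1, c.2 :\ i) | c <- S].
have wE c : w c != 0 -> [/\ i \notin c.2, c.1 0 i = t.1 0 i & z (c.1, i |: c.2) != 0].
  rewrite /w /slab; case: ifP => [/andP[ic /eqP ci]|]; last by rewrite eqxx.
  by rewrite mulf_eq0 negb_or => /andP[].
have Sw c : w c != 0 -> c \in S'.
  case/wE => ic ci /Sz zc; apply/mapP; exists (c.1, i |: c.2) => //=.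
  by rewrite setU1K //; case: (c).
have dw c : w c != 0 -> #|c.2| = d.+1.
  by case/wE => ic ci /dz /=; rewrite cardsU1 ic => -[].
have w0 : w (t.1, t.2 :\ i) != 0.
  rewrite /w /slab /= !inE eqxx /= eqxx setD1K // -surjective_pairing.
  by rewrite mulf_eq0 negb_or dirsign_neq0.
have [L [uL sL zL]] := IH w S' _ Sw dw (bd_slab _ _ zz) w0.
exists (b :: b' :: [seq (c.1, i |: c.2) | c <- L]); split => /=.
- have h c : i \notin c.2 -> c \notin [seq (c.1, i |: c.2) | c <- L].
    by move=> ic; apply/mapP => -[u _ e]; move: ic; rewrite e /= !inE eqxx.
  rewrite !inE negb_or bb' !h //= map_inj_in_uniq //.
  move=> [a1 T1] [a2 T2] /zL /wE[/= i1 _ _] /zL /wE[/= i2 _ _] [-> e].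
  by rewrite -(setU1K i1) e setU1K.
- by rewrite size_map sL [RHS]mulnS.
- move=> u; rewrite !inE => /or3P[/eqP->|/eqP->|/mapP[c /zL /wE[_ _ zc] ->]] //.
Qed.

End Chains.

(** * Vertices and facets of a cube *)

Section Vertices.
Variable n : nat.
Implicit Types (T : {set 'I_n}) (i j : 'I_n) (c : cube n).

Definition rank T i : nat := #|[set j in T | (j < i)%N]|.

Lemma count_lt_nth (s : seq nat) k : sorted ltn s -> (k < size s)%N ->
  count (fun x => x < nth 0%N s k)%N s = k.
Proof.
elim: s k => // x s IH k /= pxs.
have xs y : y \in s -> (x < y)%N.
  by move=> ys; apply: (allP (order_path_min ltn_trans pxs)).
case: k => [|k] ks /=.
  rewrite ltnn add0n (eq_in_count (a2 := pred0)) ?count_pred0 // => y /xs xy.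
  by apply/negbTE; rewrite -leqNgt ltnW.
by rewrite xs ?mem_nth // IH // (path_sorted pxs).
Qed.

Lemma rank_count T i : rank T i = count (fun x => x < i)%N (map val (enum T)).
Proof.
rewrite /rank -sum1_card count_map -sum1_count big_enum_cond /=.
by apply: eq_bigl => j; rewrite !inE.
Qed.

Lemma sorted_enum T : sorted ltn (map val (enum T)).
Proof.
rewrite sorted_map; apply: sorted_filter; first by move=> ? ? ?; exact: ltn_trans.
by rewrite -enumT -sorted_map val_enum_ord iota_ltn_sorted.
Qed.

Definition dir q c (hc : #|c.2| = q) (k : 'I_q) : 'I_n :=
  enum_val (cast_ord (esym hc) k).

Lemma dir_in q c (hc : #|c.2| = q) k : dir hc k \in c.2.
Proof. exact: enum_valP. Qed.

Lemma dir_inj q c (hc : #|c.2| = q) : injective (dir hc).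
Proof. by move=> k l /enum_val_inj/cast_ord_inj. Qed.

Lemma dir_ndc q c (hc : #|c.2| = q) k : val (dir hc k) = ndc c.2 k.
Proof.
rewrite /dir /ndc (enum_val_nth (dir hc k)) -(nth_map _ 0%N val) //.
by rewrite -cardE /= [X in (_ < X)%N]hc.
Qed.

Lemma rank_dir q c (hc : #|c.2| = q) k : rank c.2 (dir hc k) = k.
Proof.
rewrite rank_count dir_ndc /ndc count_lt_nth ?sorted_enum //.
by rewrite size_map -cardE hc.
Qed.

Lemma dir_onto q c (hc : #|c.2| = q) i : i \in c.2 -> exists k, i = dir hc k.
Proof.
move=> ic; exists (cast_ord hc (enum_rank_in ic i)).
by rewrite /dir cast_ordK enum_rankK_in.
Qed.

Lemma vert_dir q c (hc : #|c.2| = q) x k :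
  vert q c x 0 (dir hc k) = c.1 0 (dir hc k) + (x k)%:R.
Proof.
rewrite mxE; congr (_ + _).
rewrite big_mkcond (bigD1 k) //= -dir_ndc eqxx big1 ?addn0.
  by case: (x k).
move=> l lk; case: (x l) => //.
rewrite -dir_ndc; case: eqP => // /val_inj/dir_inj e.
by rewrite e eqxx in lk.
Qed.

Lemma vert_out q c (hc : #|c.2| = q) x i : i \notin c.2 -> vert q c x 0 i = c.1 0 i.
Proof.
move=> ic; rewrite mxE big1 ?addr0 // => k _.
rewrite -(dir_ndc hc); case: eqP => // /val_inj e.
by rewrite e dir_in in ic.
Qed.

Lemma vert0 q c : vert q c [ffun=> false] = c.1.
Proof. by apply/rowP => i; rewrite mxE big1 ?addr0 // => k; rewrite ffunE. Qed.

Lemma vert_inj q c : #|c.2| = q -> injective (vert q c).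
Proof.
move=> hc x y e; apply/ffunP => k.
have := congr1 (fun v : pt n => v 0 (dir hc k)) e.
by rewrite !vert_dir => /addrI; case: (x k); case: (y k).
Qed.

(* The facet of [c] on which the [k]-th nondegenerate coordinate is [b]. *)
Definition facet q c (hc : #|c.2| = q) k (b : bool) : cube n :=
  (if b then c.1 + unitv (dir hc k) else c.1, c.2 :\ dir hc k).

Lemma facet_card q c (hc : #|c.2| = q.+1) k b : #|(facet hc k b).2| = q.
Proof. by have := cardsD1 (dir hc k) c.2; rewrite dir_in hc => -[]. Qed.

(** The coface inclusion of cubical sets, the abstract counterpart of [facet]. *)
Definition face q (k : 'I_q.+1) (b : bool) (x : {ffun 'I_q -> bool}) :
  {ffun 'I_q.+1 -> bool} := [ffun m => if unlift k m is Some l then x l else b].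

Lemma face_id q (k : 'I_q.+1) b x : face k b x k = b.
Proof. by rewrite ffunE unlift_none. Qed.

Lemma face_lift q (k : 'I_q.+1) b x l : face k b x (lift k l) = x l.
Proof. by rewrite ffunE liftK. Qed.

Lemma faceP q (k : 'I_q.+1) (x : {ffun 'I_q.+1 -> bool}) :
  x = face k (x k) [ffun l => x (lift k l)].
Proof.
apply/ffunP => m; case: (unliftP k m) => [l ->|->]; last by rewrite face_id.
by rewrite face_lift ffunE.
Qed.

(** [bump] is the function underlying [lift], so this is what lets [lift k] enumerate the directions
    of the [k]-th facets. *)
Lemma rankD1 T i j : j \in T -> i \in T -> i != j ->
  rank T i = bump (rank T j) (rank (T :\ j) i).
Proof.
move=> jT iT ij.
have e : rank T i = ((j < i) + rank (T :\ j) i)%N.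
  by rewrite /rank -{1}(setD1K jT) card_ltU1 // !inE eqxx.
have iTj : i \in T :\ j by rewrite !inE ij.
have e2 : rank T j = rank (T :\ j) j.
  by rewrite /rank -{1}(setD1K jT) card_ltU1 ?ltnn // !inE eqxx.
rewrite e /bump e2; congr (_ + _)%N; congr nat_of_bool.
move: ij; rewrite -(inj_eq val_inj) neq_ltn => /orP[] h.
  rewrite ltnNge (ltnW h) /=; apply/esym/negbTE; rewrite -ltnNge.
  apply: proper_card; apply/properP; split.
    by apply/subsetP => x; rewrite !inE => /andP[-> /= /ltn_trans]; exact.
  by exists i; rewrite !inE ?ij ?iT ?h ?ltnn ?andbF //= -(inj_eq val_inj) ltn_eqF.
rewrite h; apply/esym/subset_leq_card.
by apply/subsetP => x; rewrite !inE => /andP[-> /= /ltn_trans]; exact.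
Qed.

Lemma dir_facet q c (hc : #|c.2| = q.+1) k b (hf : #|(facet hc k b).2| = q) l :
  dir hf l = dir hc (lift k l).
Proof.
have /= := dir_in hf l; rewrite !inE => /andP[ne dc].
have [m e] := dir_onto hc dc.
rewrite e; congr (dir hc _); apply: val_inj; rewrite /= -(rank_dir hc) -e.
by rewrite (@rankD1 c.2 _ (dir hc k)) ?dir_in // rank_dir -[c.2 :\ _]/((facet hc k b).2) rank_dir.
Qed.

Lemma vert_facet q c (hc : #|c.2| = q.+1) k b x :
  vert q (facet hc k b) x = vert q.+1 c (face k b x).
Proof.
apply/rowP => i; have hf := facet_card hc k b.
have [ic|ic] := boolP (i \in c.2); last first.
  rewrite !vert_out //= ?inE ?(negbTE ic) ?andbF //.
  case: b {hf} => //; rewrite mxE unitvE; case: eqP => [e|]; last by rewrite addr0.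
  by rewrite e dir_in in ic.
have [m ->] := dir_onto hc ic.
case: (unliftP k m) => [l ->|->]; last first.
  rewrite vert_dir face_id vert_out //= ?inE ?eqxx //.
  by case: b {hf}; rewrite ?addr0 // mxE unitvE eqxx.
rewrite -(dir_facet hf) (vert_dir hf) (dir_facet hf) vert_dir face_lift /=.
case: b {hf} => //; rewrite mxE unitvE (inj_eq (@dir_inj _ _ hc)).
by rewrite eq_sym (negbTE (neq_lift _ _)) addr0.
Qed.

(** Reindexes the boundary by positions instead of directions. Positions start at 0 while the signs
    count from 1, hence [k.+1]. *)
Lemma bdcoef_facet q c (hc : #|c.2| = q) t :
  bdcoef c t = \sum_(k < q) (-1) ^+ k.+1 *
    ((t == facet hc k false)%:R - (t == facet hc k true)%:R).
Proof.
rewrite /bdcoef (reindex_omap (dir hc) (fun j => [pick k | dir hc k == j])) /=.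
  apply: eq_big => k.
    rewrite dir_in; case: pickP => [l /eqP/dir_inj->|/(_ k)]; last by rewrite eqxx.
    by rewrite eqxx.
  move=> _; congr (_ ^+ _ * _); rewrite -(rank_dir hc k) /rank.
  have -> : [set i in c.2 | (i <= dir hc k)%N] =
     dir hc k |: [set j in c.2 | (j < dir hc k)%N].
    apply/setP => i; rewrite !inE leq_eqVlt (inj_eq val_inj).
    by case: (eqVneq i _) => [->|] //; rewrite dir_in.
  by rewrite cardsU1 !inE ltnn andbF.
move=> j jc; have [k ->] := dir_onto hc jc.
by case: pickP => [l /eqP e|/(_ k)]; [rewrite /= e|rewrite eqxx].
Qed.

End Vertices.

(** * Signed coefficients of a map on a cube *)

Section Coefficients.
Variable n : nat.
Implicit Types (t c : cube n) (q : nat).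

Definition iso_on q (phi : {ffun 'I_q -> bool} -> pt n) c (p : {perm 'I_q})
    (e : {ffun 'I_q -> bool}) : bool :=
  [forall x : {ffun 'I_q -> bool}, phi x == vert q c [ffun i => x (p i) (+) e i]].

Definition is_iso q (phi : {ffun 'I_q -> bool} -> pt n) c : Prop :=
  #|c.2| = q /\ exists p e, iso_on phi c p e.

(** The coefficient [fcoef] for a map on the abstract cube. The dimension test matters: on a cube
    with more than [q] directions, [vert q] sees only the first [q] of them. *)
Definition mapcoef q (phi : {ffun 'I_q -> bool} -> pt n) t : rat :=
  if #|t.2| == q then
    match [pick pe : {perm 'I_q} * {ffun 'I_q -> bool} | iso_on phi t pe.1 pe.2] with
    | Some pe => (-1) ^+ (odd_perm pe.1) * (-1) ^+ #|[set i | pe.2 i]|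
    | None => 0
    end
  else 0.

Lemma eq_mapcoef q (phi psi : {ffun 'I_q -> bool} -> pt n) t :
  phi =1 psi -> mapcoef phi t = mapcoef psi t.
Proof.
move=> e; rewrite /mapcoef; case: ifP => // _.
suff E : (fun pe : {perm 'I_q} * {ffun 'I_q -> bool} => iso_on phi t pe.1 pe.2) =1
         (fun pe => iso_on psi t pe.1 pe.2) by rewrite (eq_pick E).
by move=> pe; apply: eq_forallb => x; rewrite e.
Qed.

Lemma iso_onto q (phi : {ffun 'I_q -> bool} -> pt n) c p e y :
  iso_on phi c p e -> exists x, phi x = vert q c y.
Proof.
move=> /forallP h; exists [ffun k => y ((p^-1)%g k) (+) e ((p^-1)%g k)].
rewrite (eqP (h _)); congr (vert q c _); apply/ffunP => k.
by rewrite !ffunE permK -addbA addbb addbF.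
Qed.

(** A signed permutation of coordinates is onto, so a successful [pick] already implies the image
    test of [fcoef]. *)
Lemma fcoef_mapcoef q (f : pt n -> pt n) s t : #|t.2| = q ->
  fcoef q f s t = mapcoef (fun x => f (vert q s x)) t.
Proof.
move=> ht; rewrite /fcoef /fsign /mapcoef ht eqxx /iso_on.
case: pickP => [[p e] /= he|_]; last by case: ifP.
rewrite ifT //; apply/andP; split; apply/forallP => y; apply/existsP.
  by exists [ffun i => y (p i) (+) e i]; exact: (forallP he).
by have [x xe] := iso_onto y he; exists x; apply/eqP.
Qed.

(** So [pick] has a single candidate. The zero vertex reveals the flips; the indicator of [p i] then
    reveals [p i]. *)
Lemma iso_on_unique q (phi : {ffun 'I_q -> bool} -> pt n) c p e p' e' :
  #|c.2| = q -> iso_on phi c p e -> iso_on phi c p' e' -> (p, e) = (p', e').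
Proof.
move=> hc /forallP h /forallP h'.
have H (x : {ffun 'I_q -> bool}) i : x (p i) (+) e i = x (p' i) (+) e' i.
  have := h x; rewrite (eqP (h' x)) eq_sym => /eqP/(vert_inj hc)/ffunP/(_ i).
  by rewrite !ffunE.
have ee : e = e'.
  by apply/ffunP => i; have := H [ffun=> false] i; rewrite !ffunE.
congr pair => //; apply/permP => i.
have := H [ffun k => k == p i] i; rewrite !ffunE eqxx ee => /addIb /esym /eqP.
by move=> ->.
Qed.

Lemma mapcoef_iso q (phi : {ffun 'I_q -> bool} -> pt n) t :
  mapcoef phi t != 0 -> is_iso phi t.
Proof.
rewrite /mapcoef; case: ifP => [/eqP ht|]; last by rewrite eqxx.
case: pickP => [[p e] /= h _|]; last by rewrite eqxx.
by split => //; exists p, e.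
Qed.

Lemma vert_ge q c x i : c.1 0 i <= vert q c x 0 i.
Proof. by rewrite mxE lerDl. Qed.

(** The corner is the coordinatewise minimum of the vertices, and the all-ones vertex exceeds it
    exactly in the nondegenerate directions. *)
Lemma cube_vert_inj q c c' : #|c.2| = q -> #|c'.2| = q ->
  (forall x, exists y, vert q c x = vert q c' y) ->
  (forall y, exists x, vert q c' y = vert q c x) -> c = c'.
Proof.
move=> hc hc' h h'.
have e1 : c.1 = c'.1.
  apply/rowP => i; apply/eqP; rewrite eq_le.
  have [y hy] := h [ffun=> false]; have [x hx] := h' [ffun=> false].
  have l1 : c'.1 0 i <= c.1 0 i by rewrite -(vert0 q c) hy vert_ge.
  have l2 : c.1 0 i <= c'.1 0 i by rewrite -(vert0 q c') hx vert_ge.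
  by rewrite l1 l2.
suff e2 : c.2 = c'.2 by rewrite [c]surjective_pairing e1 e2 -surjective_pairing.
have sub (d d' : cube n) : #|d.2| = q -> #|d'.2| = q -> d.1 = d'.1 ->
    (forall x, exists y, vert q d x = vert q d' y) -> d.2 \subset d'.2.
  move=> hd hd' e k; apply/subsetP => i id; apply: contraT => id'.
  have [m im] := dir_onto hd id.
  have [y] := k [ffun=> true] => /rowP/(_ i).
  rewrite (vert_out hd') // im vert_dir ffunE -e => /eqP.
  by rewrite -subr_eq0 addrC addKr oner_eq0.
by apply/eqP; rewrite eqEsubset !sub.
Qed.

Lemma is_iso_unique q (phi : {ffun 'I_q -> bool} -> pt n) c c' :
  is_iso phi c -> is_iso phi c' -> c = c'.
Proof.
move=> [hc [p [e h]]] [hc' [p' [e' h']]].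
apply: cube_vert_inj hc hc' _ _ => y.
  have [x <-] := iso_onto y h; rewrite (eqP (forallP h' x)); eexists; reflexivity.
have [x <-] := iso_onto y h'; rewrite (eqP (forallP h x)); eexists; reflexivity.
Qed.

Lemma mapcoef_delta q (phi : {ffun 'I_q -> bool} -> pt n) c p e t :
  #|c.2| = q -> iso_on phi c p e ->
  mapcoef phi t = (-1) ^+ (odd_perm p) * (-1) ^+ #|[set i | e i]| * (t == c)%:R.
Proof.
move=> hc h; have [->|tc] := eqVneq t c.
  rewrite /mapcoef hc eqxx mulr1; case: pickP => [[p' e'] /= h'|/(_ (p, e))].
    by have [-> ->] := iso_on_unique hc h h'.
  by rewrite /= h.
rewrite mulr0; apply/eqP; apply: contraT => /mapcoef_iso it.
by move/eqP: tc; case; apply: is_iso_unique it _; split => //; exists p, e.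
Qed.

Lemma lift_permP q (p : {perm 'I_q.+1}) i : exists p', p = lift_perm i (p i) p'.
Proof.
have h l : exists m, p (lift i l) = lift (p i) m.
  case: (unliftP (p i) (p (lift i l))) => [m ->|/perm_inj e]; first by exists m.
  by have := neq_lift i l; rewrite e eqxx.
have [g gE] := fin_all_exists h.
have gi : injective g.
  by move=> l m e; apply: (@lift_inj _ i); apply: (@perm_inj _ p); rewrite !gE e.
exists (perm gi); apply/permP => m; case: (unliftP i m) => [l ->|->].
  by rewrite lift_perm_lift permE gE.
by rewrite lift_perm_id.
Qed.

(** Coordinate [i] of the image reads coordinate [p i] of the argument, so fixing the latter at [b]
    fixes the former at [b (+) e i]. *)
Lemma iso_on_face q (phi : {ffun 'I_q.+1 -> bool} -> pt n) c (hc : #|c.2| = q.+1)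
    p e i p' b :
  iso_on phi c p e -> p = lift_perm i (p i) p' ->
  iso_on (fun x => phi (face (p i) b x)) (facet hc i (b (+) e i)) p'
         [ffun l => e (lift i l)].
Proof.
move=> /forallP h pE; apply/forallP => x; rewrite (eqP (h _)) vert_facet.
apply/eqP; congr (vert _ _ _); apply/ffunP => m; rewrite ffunE.
case: (unliftP i m) => [l ->|->]; last by rewrite !face_id.
by rewrite face_lift {2}pE lift_perm_lift face_lift !ffunE.
Qed.

Lemma sign_card_lift q (e : {ffun 'I_q.+1 -> bool}) i :
  (-1) ^+ #|[set k | e k]| =
  (-1) ^+ e i * (-1) ^+ #|[set k | [ffun l => e (lift i l)] k]| :> rat.
Proof.
have h m (d : {ffun 'I_m -> bool}) : #|[set k | d k]| = (\sum_k d k)%N.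
  rewrite -sum1_card big_mkcond /=; apply: eq_bigr => k _.
  by rewrite inE; case: (d k).
rewrite !h (bigD1_ord i) //= exprD; congr (_ * _ ^+ _).
by apply: eq_bigr => l _; rewrite ffunE.
Qed.

(** The image of the boundary of the abstract cube, the chain z of the overview. *)
Definition face_sum q (phi : {ffun 'I_q.+1 -> bool} -> pt n) t : rat :=
  \sum_(k < q.+1) (-1) ^+ k.+1 *
    (mapcoef (fun x => phi (face k false x)) t - mapcoef (fun x => phi (face k true x)) t).

Lemma bd_mapcoef_iso q (phi : {ffun 'I_q.+1 -> bool} -> pt n) c t :
  is_iso phi c -> bd (mapcoef phi) t = face_sum phi t.
Proof.
move=> [hc [p [e h]]].
have isoc : is_iso phi c by split => //; exists p, e.
rewrite -(@bd_seq _ _ [:: c]) //; last first.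
  by move=> d /mapcoef_iso id; rewrite inE (is_iso_unique id isoc).
rewrite big_seq1 (mapcoef_delta _ hc h) eqxx mulr1 (bdcoef_facet hc) /face_sum.
rewrite [RHS](reindex_inj (@perm_inj _ p)) big_distrr /=; apply: eq_bigr => i _.
have [p' pE] := lift_permP p i.
have hf b := mapcoef_delta t (facet_card hc i (b (+) e i)) (iso_on_face hc b h pE).
rewrite (hf false) (hf true) (sign_card_lift e i).
(* As in a cofactor expansion: this trades the exponent [i] of the facet of [c] for the exponent
   [p i] of the face of the domain. A flip [e i] exchanges two opposite facets and brings a sign,
   and the two effects cancel. *)
have -> : (-1) ^+ odd_perm p = (-1) ^+ i * (-1) ^+ (p i) * (-1) ^+ odd_perm p' :> rat.
  by rewrite {1}pE odd_lift_perm !signr_addb !signr_odd.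
set A := _ ^+ #|_|; set B := _ ^+ odd_perm _.
rewrite !exprS; have : (-1) ^+ i * (-1) ^+ i = 1 :> rat by rewrite -expr2 sqrr_sign.
set C := _ ^+ i => CC.
case: (e i) => /=; rewrite ?expr0 ?expr1.
  rewrite -[RHS]mul1r -[X in _ = X * _]CC; ring.
rewrite -[RHS]mul1r -[X in _ = X * _]CC; ring.
Qed.

(** With the converse [affine_iso], this describes isomorphisms without naming the target cube: the
    edges at the zero vertex are signed unit vectors in distinct directions. Facets can be compared
    and glued in this form. *)
Lemma iso_affine q (phi : {ffun 'I_q -> bool} -> pt n) c : is_iso phi c ->
  exists (sg : 'I_q -> 'I_n) (s : 'I_q -> bool), injective sg /\
    forall x : {ffun 'I_q -> bool}, phi x = phi [ffun=> false] +
      \sum_k (x k)%:R *: ((-1) ^+ s k *: unitv (sg k)).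
Proof.
move=> [hc [p [e /forallP h]]].
exists (fun k => dir hc ((p^-1)%g k)), (fun k => e ((p^-1)%g k)); split.
  by move=> k l /dir_inj/perm_inj.
move=> x; rewrite !(eqP (h _)); apply/rowP => i; rewrite [RHS]mxE summxE.
under eq_bigr => k _ do rewrite !mxE eqxx /=.
have [ic|ic] := boolP (i \in c.2); last first.
  rewrite !(vert_out hc) // big1 ?addr0 // => k _.
  by case: eqP => [e1|]; [rewrite e1 dir_in in ic|rewrite !mulr0].
have [m ->] := dir_onto hc ic.
rewrite !vert_dir !ffunE (bigD1 (p m)) //= permK eqxx big1 => [|k kp].
  by rewrite -addrA; congr (_ + _); case: (x (p m)); case: (e m).
rewrite (inj_eq (@dir_inj _ _ _ hc)); case: eqP => [e1|]; last by rewrite !mulr0.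
by rewrite e1 permKV eqxx in kp.
Qed.

Lemma affine_iso q (phi : {ffun 'I_q -> bool} -> pt n) (sg : 'I_q -> 'I_n)
    (s : 'I_q -> bool) : injective sg ->
  (forall x : {ffun 'I_q -> bool}, phi x = phi [ffun=> false] +
      \sum_k (x k)%:R *: ((-1) ^+ s k *: unitv (sg k))) ->
  exists c, is_iso phi c.
Proof.
move=> sgi h.
(* A direction with negative sign is traversed downwards, so the minimal corner lies one unit below
   the image of the zero vertex there. *)
pose c : cube n := (phi [ffun=> false] - \sum_k (s k)%:R *: unitv (sg k), [set sg k | k in 'I_q]).
have hc : #|c.2| = q by rewrite card_imset // card_ord.
have H m : exists k, dir hc m = sg k.
  by have /imsetP[k _ ->] := dir_in hc m; exists k.
have [g gE] := fin_all_exists H.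
have gi : injective g by move=> k l e; apply: (@dir_inj _ _ _ hc); rewrite !gE e.
exists c; split => //; exists (perm gi), [ffun m => s (g m)].
apply/forallP => x; apply/eqP; rewrite h; apply/rowP => i; rewrite [LHS]mxE summxE.
under eq_bigr => k _ do rewrite !mxE eqxx /=.
have [ic|ic] := boolP (i \in c.2); last first.
  have ne k : (i == sg k) = false.
    by apply/eqP => e; move: ic; rewrite e; case/negP; apply/imsetP; exists k.
  rewrite (vert_out hc) // big1 => [|k _]; last by rewrite ne !mulr0.
  rewrite /c /= !mxE summxE big1 ?subr0 ?addr0 // => k _.
  by rewrite !mxE ne andbF mulr0.
have [m ->] := dir_onto hc ic.
rewrite vert_dir !ffunE permE gE (bigD1 (g m)) //= eqxx big1 => [|k kp]; last first.
  by rewrite (inj_eq sgi) eq_sym (negbTE kp) !mulr0.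
rewrite !mxE summxE (bigD1 (g m)) //= !mxE !eqxx /= big1 => [|k kp]; last first.
  by rewrite !mxE (inj_eq sgi) [g m == k]eq_sym (negbTE kp) !mulr0.
by rewrite -addrA; congr (_ + _); case: (x (g m)); case: (s (g m)).
Qed.

End Coefficients.

(** * Gluing isomorphic facets *)

Section ChainMap.
Variable n : nat.
Implicit Types (t c : cube n) (q : nat).

Definition weak_hom q (phi : {ffun 'I_q -> bool} -> pt n) : Prop :=
  forall x y : {ffun 'I_q -> bool},
    (exists k, forall m, m != k -> x m = y m) -> c1adjeq (phi x) (phi y).

Lemma weak_hom_face q (phi : {ffun 'I_q.+1 -> bool} -> pt n) k b :
  weak_hom phi -> weak_hom (fun x => phi (face k b x)).
Proof.
move=> h x y [l xy]; apply: h; exists (lift k l) => m ml.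
case: (unliftP k m) ml => [d ->|->]; last by rewrite !face_id.
by rewrite (inj_eq lift_inj) !face_lift => /xy.
Qed.

(** A pair fixes coordinate [k] and then the [l]-th of the remaining ones; the other pair fixes the
    same two coordinates in the opposite order. *)
Definition swap_faces q (kl : 'I_q.+2 * 'I_q.+1) : 'I_q.+2 * 'I_q.+1 :=
  (lift kl.1 kl.2, odflt kl.2 (unlift (lift kl.1 kl.2) kl.1)).

Lemma swap_facesP q k l : lift (@swap_faces q (k, l)).1 (swap_faces (k, l)).2 = k.
Proof.
rewrite /swap_faces /=; case: unliftP => [d e|e] /=; first by rewrite -e.
by have := neq_lift k l; rewrite -e eqxx.
Qed.

Lemma swap_facesK q : involutive (@swap_faces q).
Proof.
move=> [k l]; have := swap_facesP k l; case E : (swap_faces (k, l)) => [k' l'] /= e.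
rewrite {1}/swap_faces /= e; have -> : k' = lift k l by case: E => <-.
by rewrite liftK.
Qed.

(** The pair becomes (l+1, k) if k is at most l and (l, k-1) otherwise, so the sum of the indices
    changes by one. *)
Lemma swap_faces_sign q (kl : 'I_q.+2 * 'I_q.+1) :
  (-1) ^+ (swap_faces kl).1 * (-1) ^+ (swap_faces kl).2 =
  - ((-1) ^+ kl.1 * (-1) ^+ kl.2) :> rat.
Proof.
case: kl => k l; have := swap_facesP k l.
have : (swap_faces (k, l)).1 = lift k l by [].
case: (swap_faces (k, l)) => k' l' /= /(congr1 val) /= h1 /(congr1 val) /= h2.
rewrite -!exprD -signr_odd -[in RHS]signr_odd.
have -> : odd (k' + l') = ~~ odd (k + l) by move: h1 h2; rewrite /bump; lia.
by rewrite signrN.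
Qed.

Lemma face_comm q k l b b' (x : {ffun 'I_q -> bool}) :
  face k b (face l b' x) =
  face (swap_faces (k, l)).1 b' (face (swap_faces (k, l)).2 b x).
Proof.
have e2 := swap_facesP k l; have e1 : (swap_faces (k, l)).1 = lift k l by [].
move: e1 e2; case: (swap_faces (k, l)) => k' l' /= e1 e2.
apply/ffunP => m; case: (unliftP k m) => [a ->|->]; last first.
  by rewrite face_id -e2 face_lift face_id.
rewrite face_lift; case: (unliftP l a) => [d ->|->]; last first.
  by rewrite face_id -e1 face_id.
rewrite face_lift; case: (unliftP k' (lift k (lift l d))) => [a'|].
  move=> E; rewrite E face_lift; case: (unliftP l' a') E => [d' -> E|-> E].
    rewrite face_lift; congr (x _); apply: val_inj.
    move: e1 e2 E => /(congr1 val) /= h1 /(congr1 val) /= h2 /(congr1 val) /=.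
    by rewrite /bump in h1 h2 *; lia.
  by move: E; rewrite e2 => E; have := neq_lift k (lift l d); rewrite E eqxx.
rewrite e1 => /lift_inj E; by have := neq_lift l d; rewrite E eqxx.
Qed.

(** Once the boundary commutes with [phi] on every facet, this is the identity that a boundary has
    no boundary: [swap_faces] pairs the two listings of each face of codimension two with opposite
    signs. *)
Lemma bd_face_sum q (phi : {ffun 'I_q.+2 -> bool} -> pt n) t :
  (forall k b, bd (mapcoef (fun x => phi (face k b x))) t =
               face_sum (fun x => phi (face k b x)) t) ->
  bd (face_sum phi) t = 0.
Proof.
move=> IH; rewrite /face_sum bd_sum.
under eq_bigr => k _ do rewrite bdB !IH /face_sum -sumrB big_distrr /=.
rewrite pair_bigA /=.
pose M kl b b' := mapcoef (fun x => phi (face kl.1 b (face kl.2 b' x))) t.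
pose G kl : rat := (-1) ^+ nat_of_ord kl.1 * (-1) ^+ nat_of_ord kl.2 *
   (M kl false false - M kl false true - M kl true false + M kl true true).
have MG kl b b' : M (swap_faces kl) b b' = M kl b' b.
  by apply: eq_mapcoef => x; case: kl => k l; rewrite [in RHS]face_comm.
rewrite (eq_bigr G) => [|[k l] _]; last by rewrite /G /M /= !exprS; ring.
set A := (\sum_i G i).
have : A = - A.
  rewrite {1}/A (reindex_inj (inv_inj (@swap_facesK q))) -sumrN.
  apply: eq_bigr => kl _; rewrite /G !MG swap_faces_sign; ring.
lra.
Qed.

Lemma is_iso_corner q (phi : {ffun 'I_q -> bool} -> pt n) c :
  is_iso phi c -> exists x, phi x = c.1.
Proof.
move=> [hc [p [e h]]]; have [x ex] := iso_onto [ffun=> false] h; exists x.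
by rewrite ex vert0.
Qed.

Lemma face_sum_neq0 q (phi : {ffun 'I_q.+1 -> bool} -> pt n) t : face_sum phi t != 0 ->
  exists kb, mapcoef (fun x => phi (face kb.1 kb.2 x)) t != 0.
Proof.
move=> h; apply/existsP; apply: contraT => /existsPn no.
case/negP: h; apply/eqP; rewrite /face_sum big1 // => k _.
have e b : mapcoef (fun x => phi (face k b x)) t = 0.
  by apply/eqP; have := no (k, b); rewrite negbK.
by rewrite !e subrr mulr0.
Qed.

(* A nonzero cycle has at least as many cubes as there are facets, so that
   all facets must be mapped to distinct cubes. *)
Lemma all_facets_iso q (phi : {ffun 'I_q.+2 -> bool} -> pt n) t :
  (forall c, bd (face_sum phi) c = 0) -> face_sum phi t != 0 ->
  (forall k b, exists c, is_iso (fun x => phi (face k b x)) c) /\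
  (forall k b k' b' c, is_iso (fun x => phi (face k b x)) c ->
     is_iso (fun x => phi (face k' b' x)) c -> (k, b) = (k', b')).
Proof.
move=> zz zt; pose S := [seq (phi x, T) | x <- enum {ffun 'I_q.+2 -> bool}, T <- enum {set 'I_n}].
have Sz c : face_sum phi c != 0 -> c \in S.
  case/face_sum_neq0 => kb /mapcoef_iso/is_iso_corner[x e].
  apply/allpairsP; exists (face kb.1 kb.2 x, c.2); rewrite !mem_enum /= e.
  by split => //; case: (c).
have dz c : face_sum phi c != 0 -> #|c.2| = q.+1.
  by case/face_sum_neq0 => kb /mapcoef_iso[].
have [L [uL sL zL]] := cycle_support_size Sz dz zz zt.
(* [h] selects a facet mapped onto [c]. It is injective on [L] because a facet has at most one image
   cube, and [L] has as many cubes as there are facets, so it reaches all of them. *)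
pose h c : 'I_q.+2 * bool := odflt (ord0, false)
  [pick kb | mapcoef (fun x => phi (face kb.1 kb.2 x)) c != 0].
have hP c : c \in L -> is_iso (fun x => phi (face (h c).1 (h c).2 x)) c.
  move=> cL; rewrite /h; case: pickP => [kb /mapcoef_iso //|no].
  by have [kb] := face_sum_neq0 (zL _ cL); rewrite no.
have hi : {in L &, injective h}.
  move=> c d cL dL e; apply: is_iso_unique (hP c cL) _; rewrite e; exact: hP.
have onto kb : kb \in map h L.
  have um : uniq (map h L) by rewrite map_inj_in_uniq.
  have sub : {subset map h L <= enum {: 'I_q.+2 * bool}}.
    by move=> x _; rewrite mem_enum.
  have [|_ E] := uniq_min_size um sub.
    by rewrite -cardE card_prod card_ord card_bool size_map sL mulnC.
  by rewrite E mem_enum.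
split=> [k b|k b k' b' c i1 i2].
  have /mapP[c cL e] := onto (k, b); exists c.
  by have := hP c cL; rewrite -e.
have /mapP[c1 cL1 e1] := onto (k, b); have /mapP[c2 cL2 e2] := onto (k', b').
have ic1 : c = c1 by apply: is_iso_unique i1 _; have := hP c1 cL1; rewrite -e1.
have ic2 : c = c2 by apply: is_iso_unique i2 _; have := hP c2 cL2; rewrite -e2.
exact: etrans e1 (etrans (congr1 h (etrans (esym ic1) ic2)) (esym e2)).
Qed.

Lemma unit_eq i j (s s' : bool) :
  (-1) ^+ s *: unitv i = (-1) ^+ s' *: unitv j :> pt n -> i = j.
Proof.
move=> /rowP/(_ i); rewrite !mxE !eqxx /=; case: eqP => // _.
by rewrite mulr0 mulr1 => /eqP; rewrite signr_eq0.
Qed.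

Definition basisv q (k : 'I_q) : {ffun 'I_q -> bool} := [ffun l => l == k].

Lemma face_basis q k l : face k false (basisv l) = basisv (lift k l) :> {ffun 'I_q.+1 -> bool}.
Proof.
apply/ffunP => m; case: (unliftP k m) => [d ->|->].
  by rewrite face_lift !ffunE (inj_eq lift_inj).
by rewrite face_id ffunE (negbTE (neq_lift _ _)).
Qed.

Lemma face_false0 q k : face k false [ffun=> false] = [ffun=> false] :> {ffun 'I_q.+1 -> bool}.
Proof.
apply/ffunP => m; rewrite [RHS]ffunE; case: (unliftP k m) => [d ->|->].
  by rewrite face_lift ffunE.
by rewrite face_id.
Qed.

Lemma sum_basisv q l (v : 'I_q -> pt n) : \sum_k (basisv l k)%:R *: v k = v l.
Proof.
rewrite (bigD1 l) //= ffunE eqxx scale1r big1 ?addr0 // => k /negbTE kl.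
by rewrite ffunE kl scale0r.
Qed.

Lemma third_index q (k l : 'I_q.+3) : exists m, (m != k) && (m != l).
Proof.
have /card_gt0P[m] : (0 < #|~: [set k; l]|)%N.
  have := cardsC [set k; l]; rewrite card_ord.
  by have := cards2 k l; case: (_ != _) => /=; lia.
by rewrite !inE negb_or => h; exists m.
Qed.

(** The facets through the zero vertex make [phi] affine at every vertex but the all-ones one, and
    an opposite facet extends the formula to that vertex. *)
Lemma glue_facets q (phi : {ffun 'I_q.+3 -> bool} -> pt n) :
  (forall k b, exists c, is_iso (fun x => phi (face k b x)) c) ->
  exists c, is_iso phi c.
Proof.
move=> H; pose o : {ffun 'I_q.+3 -> bool} := [ffun=> false].
pose u k := phi (basisv k) - phi o.
have F k : exists (sg : 'I_q.+2 -> 'I_n) (s : 'I_q.+2 -> bool), injective sg /\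
    (forall l, u (lift k l) = (-1) ^+ s l *: unitv (sg l)).
  have [c /iso_affine[sg [s [sgi E]]]] := H k false.
  exists sg, s; split => // l; rewrite /u -face_basis E face_false0 sum_basisv.
  by rewrite addrC addKr.
have A0 (x : {ffun 'I_q.+3 -> bool}) k : x k = false -> phi x = phi o + \sum_m (x m)%:R *: u m.
  move=> xk; have [c /iso_affine[sg [s [sgi E]]]] := H k false.
  rewrite {1}(faceP k x) xk E face_false0; congr (_ + _).
  rewrite [RHS](bigD1_ord k) //= xk scale0r add0r; apply: eq_bigr => l _.
  rewrite ffunE; congr (_ *: _); rewrite /u -face_basis E face_false0 sum_basisv.
  by rewrite addrC addKr.
have A (x : {ffun 'I_q.+3 -> bool}) : phi x = phi o + \sum_m (x m)%:R *: u m.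
  have [/existsP[k /negbTE/A0 //]|/existsPn all1] := boolP [exists k, ~~ x k].
  have {}all1 k : x k by have := all1 k; rewrite negbK.
  have [c /iso_affine[sg [s [sgi E]]]] := H ord0 true.
  (* The edges of the upper facet at its corner are translates of edges at the zero vertex: a third
     coordinate [m] puts both in the facet where [m] is false, and [A0] applies. *)
  have v l : (-1) ^+ s l *: unitv (sg l) = u (lift ord0 l).
    have [m /andP[m0 ml]] := third_index ord0 (lift ord0 l).
    have E' : phi (face ord0 true (basisv l)) = phi o + (u ord0 + u (lift ord0 l)).
      rewrite (@A0 _ m); last first.
        case: (unliftP ord0 m) m0 ml => [d ->|-> //] _.
        by rewrite (inj_eq lift_inj) face_lift ffunE => /negbTE.
      rewrite (bigD1_ord ord0) //= face_id scale1r; congr (_ + (_ + _)).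
      under eq_bigr do rewrite face_lift.
      by rewrite sum_basisv.
    have E0 : phi (face ord0 true [ffun=> false]) = phi o + u ord0.
      rewrite /u addrC subrK; congr (phi _); apply/ffunP => m'.
      case: (unliftP ord0 m') => [d ->|->]; last by rewrite face_id ffunE eqxx.
      by rewrite face_lift !ffunE.
    by move: E'; rewrite E E0 sum_basisv -(addrA (phi o) (u ord0)) => /addrI/addrI.
  rewrite {1}(faceP ord0 x) all1 E [in RHS](bigD1_ord ord0) //= all1 scale1r (addrA (phi o)).
  congr (_ + _); last by apply: eq_bigr => l _; rewrite ffunE v.
  rewrite /u addrC subrK; congr (phi _); apply/ffunP => m'.
  case: (unliftP ord0 m') => [d ->|->]; last by rewrite face_id ffunE eqxx.
  by rewrite face_lift !ffunE.
have U k : exists js : 'I_n * bool, u k = (-1) ^+ js.2 *: unitv js.1.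
  have [m /andP[mk _]] := third_index k k; have [l ->] := unlift_some mk.
  by have [sg [s [_ ->]]] := F m; exists (sg l, s l).
have [js jsE] := fin_all_exists U.
apply: (@affine_iso _ _ phi (fun k => (js k).1) (fun k => (js k).2)).
  (* Two directions [k] and [l] are edges of the facet where a third coordinate is false, and there
     [sg] is injective. *)
  move=> k l kl; apply: contraTeq isT => nkl.
  have [m /andP[mk ml]] := third_index k l.
  have [k' ek _] := unlift_some mk; have [l' el _] := unlift_some ml.
  have [sg [s [sgi E]]] := F m.
  have := jsE k; rewrite {1}ek E => /unit_eq e1.
  have := jsE l; rewrite {1}el E => /unit_eq e2.
  by move: nkl; rewrite ek el (sgi k' l') ?eqxx // e1 e2.
by move=> x; rewrite A; congr (_ + _); apply: eq_bigr => k _; rewrite jsE.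
Qed.

End ChainMap.

(** * Continuous maps commute with the boundary *)

Section ChainMapTheorem.
Variable n : nat.
Implicit Types (t c : cube n) (q : nat).

Lemma eq_is_iso q (phi psi : {ffun 'I_q -> bool} -> pt n) c :
  phi =1 psi -> is_iso psi c -> is_iso phi c.
Proof.
move=> e [hc [p [d /forallP h]]]; split => //; exists p, d.
by apply/forallP => x; rewrite e.
Qed.

Lemma is_iso_negb q (phi : {ffun 'I_q -> bool} -> pt n) c :
  is_iso phi c -> is_iso (fun x => phi [ffun k => ~~ x k]) c.
Proof.
move=> [hc [p [e /forallP h]]]; split => //; exists p, [ffun k => ~~ e k].
apply/forallP => x; rewrite (eqP (h _)); apply/eqP; congr (vert q c _).
by apply/ffunP => i; rewrite !ffunE addbN addNb.
Qed.

Lemma ffun1 (x : {ffun 'I_1 -> bool}) : x = [ffun=> x ord0].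
Proof. by apply/ffunP => k; rewrite ffunE !ord1. Qed.

Lemma edge_affine (phi : {ffun 'I_1 -> bool} -> pt n) i (s : bool) :
  phi [ffun=> true] = phi [ffun=> false] + (-1) ^+ s *: unitv i ->
  exists c, is_iso phi c.
Proof.
move=> h; apply: (@affine_iso _ _ phi (fun=> i) (fun=> s)) => [k l _|x].
  by rewrite !ord1.
rewrite (ffun1 x) big_ord1 ffunE; case: (x ord0); first by rewrite scale1r.
by rewrite scale0r addr0.
Qed.

Lemma edge_iso (phi : {ffun 'I_1 -> bool} -> pt n) c : is_iso phi c ->
  exists i (s : bool), phi [ffun=> true] = phi [ffun=> false] + (-1) ^+ s *: unitv i.
Proof.
case/iso_affine => sg [s [_ h]]; exists (sg ord0), (s ord0).
by rewrite h big_ord1 ffunE scale1r.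
Qed.

Lemma face01 b b' :
  face (lift ord0 ord0) b [ffun=> b'] = face ord0 b' [ffun=> b] :> {ffun 'I_2 -> bool}.
Proof.
apply/ffunP => m; case: (unliftP ord0 m) => [l ->|->].
  by rewrite face_lift (ord1 l) face_id ffunE.
rewrite face_id; have [l e _] := unlift_some (isT : lift (@ord0 1) (@ord0 0) != ord0).
by rewrite {2}e face_lift ffunE.
Qed.

(** A nonzero sum of two signed unit vectors determines its summands up to order. Since the first
    summands differ, they are exchanged: the walk is a parallelogram, and [i = j] would make the sum
    zero. *)
Lemma square_units i j k l (s1 s2 s3 s4 : bool) :
  (-1) ^+ s1 *: unitv i + (-1) ^+ s3 *: unitv k =
  (-1) ^+ s2 *: unitv j + (-1) ^+ s4 *: unitv l :> pt n ->
  (-1) ^+ s1 *: unitv i != (-1) ^+ s2 *: unitv j :> pt n ->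
  (-1) ^+ s1 *: unitv i + (-1) ^+ s3 *: unitv k != 0 :> pt n ->
  i != j /\ k = j /\ s3 = s2.
Proof.
move=> /rowP E ne1 ne2.
have Em m : (-1) ^+ s1 * (m == i)%:R + (-1) ^+ s3 * (m == k)%:R =
  (-1) ^+ s2 * (m == j)%:R + (-1) ^+ s4 * (m == l)%:R :> int.
  by have := E m; rewrite !mxE eqxx.
have opp : i = k -> s3 = ~~ s1 -> False.
  by move=> ik ss; move: ne2; rewrite -ik ss signrN scaleNr subrr eqxx.
have [ij|ij] := eqVneq i j.
  subst j; have s12 : s2 = ~~ s1 by apply/eqP; move: ne1; case: (s1); case: (s2) => //; rewrite eqxx.
  have := Em i; rewrite eqxx s12.
  have := opp; case: (eqVneq i k) => [ik|_] op; last first.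
    by case: (s1); case: (s3); case: (s4); case: (i == l).
  have : s3 != ~~ s1 by apply/eqP => /op; exact.
  by case: (s1); case: (s3); case: (s4); case: (i == l).
split=> //; have Ei := Em i; have Ej := Em j.
rewrite eqxx (negbTE ij) in Ei; rewrite eqxx [j == i]eq_sym (negbTE ij) in Ej.
have [il|il] := eqVneq i l.
  rewrite -il [j == i]eq_sym (negbTE ij) in Ej.
  have [jk|jk] := eqVneq j k; last by move: Ej; rewrite (negbTE jk); case: (s1); case: (s2); case: (s3); case: (s4).
  by split=> //; move: Ej; rewrite jk eqxx; case: (s1); case: (s2); case: (s3); case: (s4).
rewrite (negbTE il) in Ei.
have [ik|ik] := eqVneq i k; last by move: Ei; rewrite (negbTE ik); case: (s1); case: (s2); case: (s3); case: (s4).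
by exfalso; apply: opp => //; move: Ei; rewrite ik eqxx; case: (s1); case: (s2); case: (s3); case: (s4).
Qed.

Lemma glue_square (phi : {ffun 'I_2 -> bool} -> pt n) :
  (forall k b, exists c, is_iso (fun x => phi (face k b x)) c) ->
  (forall k b k' b' c, is_iso (fun x => phi (face k b x)) c ->
     is_iso (fun x => phi (face k' b' x)) c -> (k, b) = (k', b')) ->
  exists c, is_iso phi c.
Proof.
move=> H D; pose P b b' := phi (face ord0 b [ffun=> b']).
pose o1 : 'I_2 := lift ord0 ord0.
have P1 b b' : phi (face o1 b' [ffun=> b]) = P b b' by rewrite /P face01.
have [c1 I1] := H o1 false; have [c2 I2] := H ord0 false.
have [c3 I3] := H ord0 true; have [c4 I4] := H o1 true.
have [i [s1 e1]] := edge_iso I1; have [j [s2 e2]] := edge_iso I2.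
have [k [s3 e3]] := edge_iso I3; have [l [s4 e4]] := edge_iso I4.
rewrite /= !P1 in e1 e4; rewrite /= -!/(P _ _) in e2 e3.
(* If the two neighbours of the zero vertex had the same image, two edges at that vertex would share
   their image. *)
have d1 : P true false != P false true.
  apply/eqP => e; suff /(D _ _ _ _ _ I1) : is_iso (fun x => phi (face ord0 false x)) c1 by [].
  apply: eq_is_iso I1 => x; rewrite (ffun1 x) P1 -/(P _ _).
  by case: (x ord0).
(* If these opposite vertices had the same image, the second edge of a path between them would
   retrace the first one backwards. *)
have d2 : P true true != P false false.
  apply/eqP => e; suff /(D _ _ _ _ _ I1) : is_iso (fun x => phi (face ord0 true x)) c1 by [].
  apply: eq_is_iso (is_iso_negb I1) => x /=.
  have -> : [ffun k0 => ~~ x k0] = [ffun=> ~~ x ord0] :> {ffun 'I_1 -> bool}.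
    by apply/ffunP => m; rewrite !ffunE ord1.
  by rewrite {1}(ffun1 x) P1 -/(P _ _); case: (x ord0).
have [ij [kj s32]] : i != j /\ k = j /\ s3 = s2.
  apply: (@square_units i j k l s1 s2 s3 s4).
  - by apply: (addrI (P false false)); rewrite !addrA -e1 -e2 -e3 -e4.
  - by move: d1; rewrite e1 e2 (inj_eq (addrI _)).
  - by apply: contra d2 => /eqP e; rewrite e3 e1 -addrA e addr0.
rewrite kj s32 in e3.
pose sg (m : 'I_2) := if m == ord0 then i else j; pose s (m : 'I_2) := if m == ord0 then s1 else s2.
have o1E : (o1 == ord0) = false by [].
apply: (@affine_iso _ _ phi sg s) => [m m'|x].
  rewrite /sg; case: (unliftP ord0 m) => [? ->|->]; case: (unliftP ord0 m') => [? ->|->] //=.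
  - by rewrite !ord1.
  - by move/eqP; rewrite eq_sym (negbTE ij).
  - by move/eqP; rewrite (negbTE ij).
have -> : phi [ffun=> false] = P false false.
  by rewrite /P face_false0.
rewrite big_ord_recl big_ord1 /sg /s -/o1 o1E eqxx.
have -> : phi x = P (x ord0) (x o1).
  rewrite {1}(faceP ord0 x) /P; congr (phi (face _ _ _)); apply/ffunP => m.
  by rewrite !ffunE ord1.
case: (x ord0); case: (x o1); rewrite ?scale1r ?scale0r ?addr0 ?add0r //.
by rewrite e3 e1 addrA.
Qed.

(** Without an isomorphism [mapcoef phi] is zero, so the identity then only asks that [face_sum]
    vanish. *)
Lemma bd_mapcoef_of_iso q (phi : {ffun 'I_q.+1 -> bool} -> pt n) :
  (forall t, face_sum phi t != 0 -> exists c, is_iso phi c) ->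
  forall t, bd (mapcoef phi) t = face_sum phi t.
Proof.
move=> H t; have [z0|/H[c /bd_mapcoef_iso->//]] := eqVneq (face_sum phi t) 0.
rewrite z0; apply/eqP; apply: contraT => b0.
suff [c ic] : exists c, is_iso phi c by rewrite (bd_mapcoef_iso t ic) z0 eqxx in b0.
have : [exists j, (mapcoef phi (t.1, j |: t.2) != 0) ||
                  (mapcoef phi (t.1 - unitv j, j |: t.2) != 0)].
  apply: contraT => /existsPn no; case/negP: b0; rewrite /bd big1 // => j _.
  by have := no j; rewrite negb_or !negbK => /andP[/eqP-> /eqP->]; rewrite subrr mulr0.
by case/existsP => j /orP[] /mapcoef_iso ?; eexists; eassumption.
Qed.

Theorem bd_mapcoef q (phi : {ffun 'I_q.+1 -> bool} -> pt n) : weak_hom phi ->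
  forall t, bd (mapcoef phi) t = face_sum phi t.
Proof.
elim: q phi => [|q IH] phi wh; apply: bd_mapcoef_of_iso => t zt.
  have /orP[/eqP e|] : c1adjeq (phi [ffun=> false]) (phi [ffun=> true]).
  - by apply: wh; exists ord0 => m; rewrite ord1.
  - case/negP: zt; apply/eqP; rewrite /face_sum big_ord1.
    rewrite (@eq_mapcoef _ _ _ (fun x => phi (face ord0 true x))) ?subrr ?mulr0 // => x.
    have h b : face ord0 b x = [ffun=> b] :> {ffun 'I_1 -> bool}.
      by rewrite (ffun1 (face _ _ _)) face_id.
    by rewrite !h.
  - case/existsP => i /andP[d /forallP same].
    set u := phi _ in d same; set v := phi _ in d same.
    (* The step from [u] to [v] is negative exactly when coordinate [i] decreases. *)
    apply: (@edge_affine phi i (v 0 i < u 0 i)); rewrite -/u -/v; apply/rowP => j.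
    rewrite !mxE eqxx /=; have := same j; have [->|ji] /= := eqVneq j i.
      by move=> _; move: d; case: ltP => /=; rewrite ?expr0 ?expr1; lia.
    by move=> /eqP ->; rewrite mulr0 addr0.
have cyc c : bd (face_sum phi) c = 0.
  by apply: bd_face_sum => k b; apply: IH; exact: weak_hom_face.
have [H D] := all_facets_iso cyc zt.
by case: q phi {IH wh zt cyc} H D => [|q] phi H D; [exact: glue_square|exact: glue_facets].
Qed.

End ChainMapTheorem.

(** * The prism operator *)

Section Prism.
Variables (n : nat) (X : {fset pt n}).
Implicit Types (t c s : cube n) (q : nat) (f g : pt n -> pt n).

Lemma cubes_uniq q : uniq (cubes X q).
Proof.
apply/filter_uniq/allpairs_uniq => [||[a T] [b U] _ _ /= [-> ->] //].
  exact: fset_uniq.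
exact: enum_uniq.
Qed.

Lemma cubesP q c : reflect (#|c.2| = q /\ forall x, vert q c x \in X) (c \in cubes X q).
Proof.
rewrite mem_filter /cube_in -andbA; apply: (iffP and3P) => [[/eqP hc /forallP h _]|[hc h]].
  by split.
split; [exact/eqP|exact/forallP|].
apply/allpairsP; exists c; split; [|by rewrite mem_enum|by case: (c)].
by rewrite -(vert0 q c); exact: h.
Qed.

Lemma cub_in q (i : 'I_(Ncub X q)) : cub X q i \in cubes X q.
Proof. exact: mem_nth. Qed.

Lemma sum_cubes q (F : cube n -> rat) :
  \sum_(i < Ncub X q) F (cub X q i) = \sum_(c <- cubes X q) F c.
Proof. by rewrite (big_nth (cube0 n)) big_mkord. Qed.

Lemma mapcoef_cubes q (phi : {ffun 'I_q -> bool} -> pt n) c :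
  (forall x, phi x \in X) -> mapcoef phi c != 0 -> c \in cubes X q.
Proof.
move=> hX /mapcoef_iso[hc [p [e h]]]; apply/cubesP; split => // y.
by have [x <-] := iso_onto y h.
Qed.

Lemma facet_cubes q c (hc : #|c.2| = q.+1) k b :
  c \in cubes X q.+1 -> facet hc k b \in cubes X q.
Proof.
case/cubesP => _ h; apply/cubesP; split; first exact: facet_card.
by move=> x; rewrite vert_facet.
Qed.

(** Time is coordinate [ord0], so the ends are the first pair of faces and the sides have index
    [lift ord0 l]. *)
Definition prism f g q s (x : {ffun 'I_q.+1 -> bool}) : pt n :=
  (if x ord0 then g else f) (vert q s [ffun l => x (lift ord0 l)]).

Lemma prism_end f g q s b x :
  prism f g s (face ord0 b x) = (if b then g else f) (vert q s x).
Proof.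
rewrite /prism face_id; congr ((if b then g else f) (vert q s _)).
by apply/ffunP => l; rewrite ffunE face_lift.
Qed.

Lemma prism_side f g q s (hs : #|s.2| = q.+1) l b x :
  prism f g s (face (lift ord0 l) b x) = prism f g (facet hs l b) x.
Proof.
rewrite /prism vert_facet.
have e0 : ord0 = lift (lift ord0 l) ord0 :> 'I_q.+2 by apply: val_inj.
have -> : face (lift ord0 l) b x ord0 = x ord0.
  by rewrite [X in face _ _ _ X]e0 face_lift.
congr ((if x ord0 then g else f) (vert _ _ _)).
apply/ffunP => m; rewrite ffunE; case: (unliftP l m) => [d ->|->]; last by rewrite !face_id.
rewrite face_lift.
have -> : lift ord0 (lift l d) = lift (lift ord0 l) (lift ord0 d).
  by apply: val_inj; rewrite /= /bump; lia.
by rewrite face_lift ffunE.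
Qed.

Lemma vert_adj q s (x y : {ffun 'I_q -> bool}) k : #|s.2| = q ->
  (forall m, m != k -> x m = y m) -> c1adjeq (vert q s x) (vert q s y).
Proof.
move=> hs xy; have [e|ne] := eqVneq (x k) (y k).
  have -> : x = y by apply/ffunP => m; have [->|/xy] := eqVneq m k.
  by rewrite /c1adjeq eqxx.
apply/orP; right; apply/existsP; exists (dir hs k); apply/andP; split.
  by rewrite !vert_dir opprD addrACA subrr add0r; move: ne; case: (x k); case: (y k).
apply/forallP => j; apply/implyP => jk.
have [js|js] := boolP (j \in s.2); last by rewrite !(vert_out hs).
have [m jm] := dir_onto hs js; rewrite jm !vert_dir xy //.
by apply: contra jk => /eqP <-; rewrite jm.
Qed.

(** * Chain homotopy and traces for one step of the homotopy *)

Section Step.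
Variables f g : pt n -> pt n.
Hypotheses (fX : maps_into X f) (gX : maps_into X g).
Hypotheses (fc : dcontinuous X f) (gc : dcontinuous X g).
Hypothesis fg : forall x, x \in X -> c1adjeq (f x) (g x).

Lemma prism_weak_hom q s : s \in cubes X q -> weak_hom (@prism f g q s).
Proof.
case/cubesP => hs h x y [k xy]; rewrite /prism.
case: (unliftP ord0 k) => [l kl|k0].
  have <- : x ord0 = y ord0 by apply: xy; rewrite kl neq_lift.
  have /orP[/eqP->|adj] : c1adjeq (vert q s [ffun l => x (lift ord0 l)])
                                  (vert q s [ffun l => y (lift ord0 l)]).
  - apply: (@vert_adj _ _ _ _ l hs) => m ml; rewrite !ffunE; apply: xy.
    by rewrite kl (inj_eq lift_inj).
  - by rewrite /c1adjeq eqxx.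
  - by case: (x ord0); [apply: gc|apply: fc].
have -> : [ffun l => y (lift ord0 l)] = [ffun l => x (lift ord0 l)] :> {ffun 'I_q -> bool}.
  by apply/ffunP => l; rewrite !ffunE; apply/esym/xy; rewrite k0.
have sym (u v : pt n) : c1adjeq u v = c1adjeq v u.
  rewrite /c1adjeq eq_sym; congr (_ || _); apply: eq_existsb => i.
  by rewrite distrC; congr (_ && _); apply: eq_forallb => j; rewrite [u 0 j == _]eq_sym.
case: (x ord0); case: (y ord0); rewrite ?(sym (g _)) ?fg //; by rewrite /c1adjeq eqxx.
Qed.

Lemma prism_in q s x : s \in cubes X q -> @prism f g q s x \in X.
Proof.
by case/cubesP => hs h; rewrite /prism; case: (x ord0); [apply: gX|apply: fX].
Qed.

(** The pair of ends carries the sign -1, which gives [g] minus [f]; the shift by one past the time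
    coordinate turns the sign of side [l] into [(-1) ^+ l]. *)
Lemma bd_prism q (i j : 'I_(Ncub X q)) :
  \sum_(k < Ncub X q.+1) mapcoef (@prism f g q (cub X q i)) (cub X q.+1 k) *
     bdcoef (cub X q.+1 k) (cub X q j) =
  chainmx X g q i j - chainmx X f q i j +
  \sum_(l < q) (-1) ^+ l *
    (mapcoef (fun x => prism f g (cub X q i) (face (lift ord0 l) false x)) (cub X q j) -
     mapcoef (fun x => prism f g (cub X q i) (face (lift ord0 l) true x)) (cub X q j)).
Proof.
have ci := cub_in i; have /cubesP[hj _] := cub_in j.
rewrite (sum_cubes q.+1 (fun c => mapcoef (prism f g (cub X q i)) c * bdcoef c (cub X q j))).
rewrite bd_seq ?cubes_uniq //; last by move=> c; apply: mapcoef_cubes => x; exact: prism_in.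
rewrite bd_mapcoef; last exact: prism_weak_hom.
rewrite /face_sum big_ord_recl !mxE !fcoef_mapcoef //; congr (_ + _).
  rewrite expr1 mulN1r opprB; congr (_ - _); apply: eq_mapcoef => x; exact: prism_end.
by apply: eq_bigr => l _; rewrite /= /bump /= add1n !exprS !mulN1r opprK.
Qed.

Lemma chain_homotopy q : exists A B,
  chainmx X f q - chainmx X g q = A *m bdmx X q.+1 + bdmx X q *m B.
Proof.
pose A : 'M[rat]_(Ncub X q, Ncub X q.+1) :=
  \matrix_(i, k) - mapcoef (@prism f g q (cub X q i)) (cub X q.+1 k).
have AE i j : (A *m bdmx X q.+1) i j = - (\sum_(k < Ncub X q.+1)
    mapcoef (@prism f g q (cub X q i)) (cub X q.+1 k) * bdcoef (cub X q.+1 k) (cub X q j)).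
  by rewrite mxE -sumrN; apply: eq_bigr => k _; rewrite !mxE mulNr.
(* A prism over a point has no sides, so in degree 0 the second term is zero; in higher degrees the
   sides are prisms over facets. *)
case: q A AE => [|q] A AE.
  exists A, 0; rewrite mulmx0 addr0; apply/matrixP => i j.
  by rewrite AE bd_prism big_ord0 !mxE; ring.
exists A, (\matrix_(k, j) - mapcoef (@prism f g q (cub X q k)) (cub X q.+1 j)).
apply/matrixP => i j; rewrite [RHS]mxE AE bd_prism.
have ci := cub_in i; have /cubesP[hi _] := ci.
have -> : (bdmx X q.+1 *m (\matrix_(k, j) - mapcoef (@prism f g q (cub X q k)) (cub X q.+1 j))) i j
  = \sum_(l < q.+1) (-1) ^+ l *
     (mapcoef (@prism f g q (facet hi l false)) (cub X q.+1 j) -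
      mapcoef (@prism f g q (facet hi l true)) (cub X q.+1 j)).
  rewrite mxE.
  under eq_bigr => k _ do rewrite !mxE (bdcoef_facet hi).
  pose F c := mapcoef (@prism f g q c) (cub X q.+1 j).
  rewrite (sum_cubes q (fun c => (\sum_(l < q.+1) (-1) ^+ l.+1 *
    ((c == facet hi l false)%:R - (c == facet hi l true)%:R)) * - F c)).
  under eq_bigr => c _ do rewrite big_distrl /=.
  rewrite exchange_big /=; apply: eq_bigr => l _; rewrite -!/(F _).
  have d b : \sum_(c <- cubes X q) (c == facet hi l b)%:R * F c = F (facet hi l b).
    by apply: sum_delta => [|_]; [exact: cubes_uniq|exact: facet_cubes].
  rewrite -!d -sumrB big_distrr /=; apply: eq_bigr => c _.
  by rewrite exprS; ring.
rewrite !mxE.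
have -> : \sum_(l < q.+1) (-1) ^+ l *
    (mapcoef (fun x => prism f g (cub X q.+1 i) (face (lift ord0 l) false x)) (cub X q.+1 j) -
     mapcoef (fun x => prism f g (cub X q.+1 i) (face (lift ord0 l) true x)) (cub X q.+1 j)) =
  \sum_(l < q.+1) (-1) ^+ l *
     (mapcoef (@prism f g q (facet hi l false)) (cub X q.+1 j) -
      mapcoef (@prism f g q (facet hi l true)) (cub X q.+1 j)).
  by apply: eq_bigr => l _; congr (_ * (_ - _)); apply: eq_mapcoef => x; exact: prism_side.
ring.
Qed.

(** The matrices agree before the trace is taken: the term through [bdmx X q] vanishes on [W], which
    lies in the kernel, and the term ending in [bdmx X q.+1] is killed by the projection along its
    row space. *)
Lemma homtrace_step q : homtrace X f q = homtrace X g q.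
Proof.
have [A [B e]] := chain_homotopy q.
rewrite /homtrace; set W := (_ :\: _)%MS; set R := row_base W.
congr (\tr (_ *m _)); apply: subr0_eq; rewrite -mulmxBl -mulmxBr e mulmxDr.
have -> : R *m (bdmx X q *m B) = 0.
  rewrite mulmxA; have /sub_kermxP-> : (R <= kermx (bdmx X q))%MS; last by rewrite mul0mx.
  by rewrite eq_row_base diffmxSl.
rewrite addr0 proj_mx_0 //; last by rewrite genmxE mulmxA submxMl.
by apply/eqP; rewrite -submx0 (cap_eqmx (eqmx_refl _) (genmxE _)) capmx_diff sub0mx.
Qed.

Lemma lefschetz_step : lefschetz X f = lefschetz X g.
Proof. by apply: eq_bigr => q _; rewrite homtrace_step. Qed.

End Step.
End Prism.

Theorem theorem4p2 (n : nat) (hn : (n <= 3)%N) (X : {fset 'rV[int]_n})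
  (f g : 'rV[int]_n -> 'rV[int]_n) :
  maps_into X f -> maps_into X g ->
  dcontinuous X f -> dcontinuous X g ->
  dhomotopic X f g ->
  lefschetz X f = lefschetz X g.
Proof.
move=> fX gX fc gc [m [H [_ [H0 [Hm [HX [Ht Hc]]]]]]].
have step t : (t <= m)%N -> lefschetz X f = lefschetz X (fun x => H x t).
  elim: t => [_|t IH tm].
    (* [f] and [H _ 0] agree only on [X]; their equality there counts as one more, stationary step.
       The same is done with [g] at time [m]. *)
    apply: lefschetz_step fX _ fc _ _ => [x xX||x xX]; [exact: HX|exact: Hc|].
    by rewrite /c1adjeq H0 ?eqxx.
  apply: etrans (IH (ltnW tm)) _; apply: lefschetz_step => [x xX|x xX|||x xX].
  - exact: HX xX (ltnW tm).
  - exact: HX.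
  - exact: Hc (ltnW tm).
  - exact: Hc.
  - exact: Ht.
apply: etrans (step m (leqnn m)) _.
apply: lefschetz_step _ gX _ gc _ => [x xX||x xX]; [exact: HX|exact: Hc|].
by rewrite /c1adjeq Hm ?eqxx.
Qed.
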